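(* The Right Planar Rook Monoid $RP_n$ is generated by the diagrams $r_i$ ($1\le i\le n-1$) and $p_i$ ($1\le i\le n$) subject to the following relations (that is, these generators and relations form a monoid presentation of $RP_n$), where each relation is imposed for all indices for which every letter occurring in it is defined: 1. $r_ir_{i+1}r_i=r_{i+1}r_ir_{i+1}$; 2. $r_i^2=r_i^3=r_ip_i=p_ip_{i+1}$; 3. $r_i=p_ir_i=r_ip_{i+1}$; 4. $p_ir_{i+1}=r_{i+1}p_i$; 5. $p_i^2=p_i$; 6. $p_ip_j=p_jp_i$; 7. if $|i-j|\ge 2$ then $p_ir_j=r_jp_i$ and $r_ir_j=r_jr_i$.
   Context: A planar rook diagram on $n$ has a top row of vertices $1,\dots,n$ and a bottom row $1',\dots,n'$, with edges each joining a top vertex to a bottom vertex, every vertex on at most one edge, and no two edges crossing. Equivalently it is an order-preserving injective partial function on $\{1,\dots,n\}$, from top to bottom. The product $d_1d_2$ is obtained by stacking $d_1$ above $d_2$, identifying the bottom row of $d_1$ with the top row of $d_2$: $a$ is joined to $c'$ in $d_1d_2$ iff there is $b$ such that $a$ is joined to $b'$ in $d_1$ and $b$ is joined to $c'$ in $d_2$. The Right Planar Rook Monoid $RP_n$ is the monoid of all planar rook diagrams in which every edge joining top vertex $a$ to bottom vertex $b'$ satisfies $a\ge b$. The diagram $r_i$ ($1\le i\le n-1$) has edges $\{m,m'\}$ for $m\ne i,i+1$ and the edge $\{i+1,i'\}$. The diagram $p_i$ ($1\le i\le n$) has exactly the edges $\{m,m'\}$ for $m\ne i$. *)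

(* Defs.v *)
From HB Require Import structures.
From mathcomp Require Import all_boot.

Set Implicit Arguments.
Unset Strict Implicit.
Unset Printing Implicit Defensive.

Local Open Scope group_scope.

Section Presentation.
Variables (X : Type) (rel : seq X -> seq X -> Prop).

(* Words over X form the free monoid on X. *)
Inductive generated_congruence : seq X -> seq X -> Prop :=
| gcongr_rel u v : rel u v -> generated_congruence u v
| gcongr_refl u : generated_congruence u u
| gcongr_sym u v : generated_congruence u v -> generated_congruence v u
| gcongr_trans u v w :
    generated_congruence u v -> generated_congruence v w ->
    generated_congruence u w
| gcongr_cat u1 v1 u2 v2 :
    generated_congruence u1 v1 -> generated_congruence u2 v2 ->
    generated_congruence (u1 ++ u2) (v1 ++ v2).

Variables (M : monoidType) (f : X -> M).

Definition word_eval (w : seq X) : M := \prod_(x <- w) f x.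

(* The monoid morphism from the free monoid on X to M extending f is
   surjective and its kernel is the congruence generated by rel, i.e., it
   induces an isomorphism of the quotient monoid onto M. *)
Definition monoid_presentation : Prop :=
  (forall m : M, exists w : seq X, word_eval w = m) /\
  (forall u v : seq X, word_eval u = word_eval v <-> generated_congruence u v).

End Presentation.

Section PlanarRookDiagrams.
Variable n : nat.

(* Vertices are numbered from 0; the edge joining top vertex a to bottom
   vertex b' is the pair (a, b). *)
Definition is_planar_rook (d : {set 'I_n * 'I_n}) : bool :=
  [forall e in d, forall f in d,
    [&& (e.1 == f.1) ==> (e == f),
        (e.2 == f.2) ==> (e == f)
      & ~~ ((e.1 < f.1) && (f.2 < e.2))]].

Record planar_rook := PlanarRook {
  edges : {set 'I_n * 'I_n};
  edgesP : is_planar_rook edges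
}.

HB.instance Definition _ := [isSub for edges].
HB.instance Definition _ := [Finite of planar_rook by <:].

Lemma is_planar_rookP (d : {set 'I_n * 'I_n}) :
  reflect (forall a b a' b', (a, b) \in d -> (a', b') \in d ->
             [/\ a = a' -> b = b', b = b' -> a = a' & a < a' -> b <= b'])
          (is_planar_rook d).
Proof.
apply: (iffP forall_inP) => [H a b a' b' dab dab' | H [a b] dab].
  have /forall_inP/(_ _ dab')/and3P[/= h1 h2 h3] := H _ dab.
  split=> [E | E | lt]; last by move: h3; rewrite lt -leqNgt.
    by move: h1; rewrite E eqxx => /eqP[].
  by move: h2; rewrite E eqxx => /eqP[].
apply/forall_inP => [[a' b'] dab'] /=; have [h1 h2 h3] := H _ _ _ _ dab dab'.
apply/and3P; split.
- by apply/implyP => /eqP E; rewrite -(h1 E) E.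
- by apply/implyP => /eqP E; rewrite -(h2 E) E.
- by apply/negP => /andP[/h3]; rewrite leqNgt => /negP.
Qed.

Definition stack (d1 d2 : {set 'I_n * 'I_n}) : {set 'I_n * 'I_n} :=
  [set e | [exists b, ((e.1, b) \in d1) && ((b, e.2) \in d2)]].

Lemma stackP (d1 d2 : {set 'I_n * 'I_n}) a c :
  reflect (exists2 b, (a, b) \in d1 & (b, c) \in d2) ((a, c) \in stack d1 d2).
Proof.
rewrite inE /=; apply: (iffP existsP) => [[b /andP[]] | [b h1 h2]]; exists b => //.
exact/andP.
Qed.

Definition identity : {set 'I_n * 'I_n} := [set e | e.1 == e.2].

Lemma stack_planar (d1 d2 : planar_rook) :
  is_planar_rook (stack (edges d1) (edges d2)).
Proof.
have /is_planar_rookP H1 := edgesP d1; have /is_planar_rookP H2 := edgesP d2.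
apply/is_planar_rookP => a c a' c' /stackP[b h1 h2] /stackP[b' h1' h2'].
have [f1 g1 m1] := H1 _ _ _ _ h1 h1'; have [f2 g2 m2] := H2 _ _ _ _ h2 h2'.
split; [by move/f1/f2 | by move/g2/g1 |] => lt.
move: (m1 lt); rewrite leq_eqVlt => /orP[/eqP/val_inj/g1 E | /m2 //].
by rewrite E ltnn in lt.
Qed.

Lemma identity_planar : is_planar_rook identity.
Proof.
by apply/is_planar_rookP => a b a' b'; rewrite !inE => /eqP/= <- /eqP/= <-;
  split=> // /ltnW.
Qed.

Definition planar_rook_mul d1 d2 := PlanarRook (stack_planar d1 d2).
Definition planar_rook_one := PlanarRook identity_planar.

Lemma planar_rook_mulA : associative planar_rook_mul.
Proof.
move=> d1 d2 d3; apply/val_inj/setP => [[a d]] /=; apply/stackP/stackP.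
  by case=> b ab /stackP[c bc cd]; exists c => //; apply/stackP; exists b.
by case=> c /stackP[b ab bc] cd; exists b => //; apply/stackP; exists c.
Qed.

Lemma planar_rook_mul1 : left_id planar_rook_one planar_rook_mul.
Proof.
move=> d; apply/val_inj/setP => [[a c]] /=; apply/stackP/idP.
  by case=> b; rewrite inE => /eqP/= ->.
by exists a; rewrite ?inE.
Qed.

Lemma planar_rook_mulr1 : right_id planar_rook_one planar_rook_mul.
Proof.
move=> d; apply/val_inj/setP => [[a c]] /=; apply/stackP/idP.
  by case=> b h; rewrite inE => /eqP/= <-.
by exists c; rewrite ?inE.
Qed.

HB.instance Definition _ := isMonoid.Build planar_rook
  planar_rook_mulA planar_rook_mul1 planar_rook_mulr1.

Definition right_diagram : {pred planar_rook} :=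
  fun d => [forall e in edges d, e.2 <= e.1].

Lemma right_diagramP (d : planar_rook) :
  reflect (forall a b, (a, b) \in edges d -> b <= a) (d \in right_diagram).
Proof.
by apply: (iffP forall_inP) => [H a b /H | H [a b] /H].
Qed.

Lemma right_diagram_closed : monoid_closed right_diagram.
Proof.
split=> [|d1 d2 /right_diagramP h1 /right_diagramP h2]; apply/right_diagramP.
  by move=> a b; rewrite inE => /eqP/= ->.
move=> a c /stackP[b /h1 ba /h2 cb]; exact: leq_trans cb ba.
Qed.

Record RP := RightPlanarRook {
  RP_val : planar_rook;
  RP_valP : RP_val \in right_diagram
}.

HB.instance Definition _ := [isSub for RP_val].
HB.instance Definition _ := [Finite of RP by <:].
HB.instance Definition _ :=
  SubChoice_isSubMonoid.Build planar_rook right_diagram RP right_diagram_closed.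

(* As vertices are numbered from 0, i : 'I_n.-1 stands for the index i + 1 of
   r_i, and i : 'I_n for the index i + 1 of p_i. *)
Definition r_edges (i : 'I_n.-1) : {set 'I_n * 'I_n} :=
  [set e : 'I_n * 'I_n |
    [&& e.1 == e.2, e.1 != i :> nat & e.1 != i.+1 :> nat]
    || (e.1 == i.+1 :> nat) && (e.2 == i :> nat)].

Definition p_edges (i : 'I_n) : {set 'I_n * 'I_n} :=
  [set e | (e.1 == e.2) && (e.1 != i)].

Lemma r_edges_planar i : is_planar_rook (r_edges i).
Proof.
apply/is_planar_rookP => a b a' b'; rewrite !inE /=.
move=> /orP[/and3P[/eqP <- /eqP ai /eqP aj] | /andP[/eqP aj /eqP bi]].
  move=> /orP[/and3P[/eqP <- _ _] | /andP[/eqP aj' /eqP bi']].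
    by split=> // /ltnW.
  split=> [E | E | ]; first by case: aj; rewrite E.
    by case: ai; rewrite E.
  by rewrite aj' bi' ltnS.
move=> /orP[/and3P[/eqP <- /eqP ai /eqP aj'] | /andP[/eqP aj' /eqP bi']].
  split=> [E | E | ]; first by case: aj'; rewrite -E.
    by case: ai; rewrite -E.
  by rewrite aj bi => /ltnW/ltnW.
split=> _; [by apply: val_inj; rewrite /= bi bi' | | by rewrite bi bi'].
by apply: val_inj; rewrite /= aj aj'.
Qed.

Lemma p_edges_planar i : is_planar_rook (p_edges i).
Proof.
apply/is_planar_rookP => a b a' b'; rewrite !inE /=.
by move=> /andP[/eqP <- _] /andP[/eqP <- _]; split=> // /ltnW.
Qed.

Lemma r_right i : PlanarRook (r_edges_planar i) \in right_diagram.
Proof.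
apply/right_diagramP => a b; rewrite inE /=.
by move=> /orP[/and3P[/eqP <-] | /andP[/eqP -> /eqP ->]].
Qed.

Lemma p_right i : PlanarRook (p_edges_planar i) \in right_diagram.
Proof.
by apply/right_diagramP => a b; rewrite inE /= => /andP[/eqP <-].
Qed.

Definition RP_r (i : 'I_n.-1) : RP := RightPlanarRook (r_right i).
Definition RP_p (i : 'I_n) : RP := RightPlanarRook (p_right i).

Inductive RP_gen := gen_r of 'I_n.-1 | gen_p of 'I_n.

Definition RP_gen_diagram (g : RP_gen) : RP :=
  match g with gen_r i => RP_r i | gen_p i => RP_p i end.

Local Notation r := gen_r.
Local Notation p := gen_p.

(* The letters r i and p i' with i : 'I_n.-1, i' : 'I_n have the same index when
   i' = i as naturals; an equality such as j = i.+1 :> nat between ordinals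
   expresses a shifted index together with its being in range. *)
Inductive RP_rel : seq RP_gen -> seq RP_gen -> Prop :=
| RP_braid (i j : 'I_n.-1) of j = i.+1 :> nat :
    RP_rel [:: r i; r j; r i] [:: r j; r i; r j]
| RP_sqr_cube (i : 'I_n.-1) :
    RP_rel [:: r i; r i] [:: r i; r i; r i]
| RP_cube_rp (i : 'I_n.-1) (i' : 'I_n) of i' = i :> nat :
    RP_rel [:: r i; r i; r i] [:: r i; p i']
| RP_rp_pp (i : 'I_n.-1) (i' j' : 'I_n)
    of i' = i :> nat & j' = i.+1 :> nat :
    RP_rel [:: r i; p i'] [:: p i'; p j']
| RP_r_pr (i : 'I_n.-1) (i' : 'I_n) of i' = i :> nat :
    RP_rel [:: r i] [:: p i'; r i]
| RP_pr_rp (i : 'I_n.-1) (i' j' : 'I_n)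
    of i' = i :> nat & j' = i.+1 :> nat :
    RP_rel [:: p i'; r i] [:: r i; p j']
| RP_pr_next (i : 'I_n) (j : 'I_n.-1) of j = i.+1 :> nat :
    RP_rel [:: p i; r j] [:: r j; p i]
| RP_p_idem (i : 'I_n) :
    RP_rel [:: p i; p i] [:: p i]
| RP_p_comm (i j : 'I_n) :
    RP_rel [:: p i; p j] [:: p j; p i]
| RP_pr_far (i : 'I_n) (j : 'I_n.-1) of (i.+2 <= j) || (j.+2 <= i) :
    RP_rel [:: p i; r j] [:: r j; p i]
| RP_r_far (i j : 'I_n.-1) of (i.+2 <= j) || (j.+2 <= i) :
    RP_rel [:: r i; r j] [:: r j; r i].

End PlanarRookDiagrams.

(* Main.v *)
Require Import Defs.
From mathcomp Require Import all_boot.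
From mathcomp Require Import zify.
From Corelib Require Import Setoid Morphisms.

(** Read a diagram as a partial map F on {0, ..., n-1}, strictly increasing and
    with F a <= a.  It is the product L_0 L_1 ... L_{n-1}, where L_a = p_a if
    F a is undefined and L_a = r_{a-1} ... r_b if F a = b: the prefix
    L_0 ... L_{a-1} only reaches bottom vertices less than b, so L_a moves a to
    b without disturbing the earlier edges.  The relations rewrite a generator
    followed by such a normal form into the normal form of the product, because
    the prefix L_0 ... L_{a-1} absorbs on its right every p_t with t < a outside
    its image.  Hence every word is congruent to a normal form that depends
    only on its value. *)

Set Implicit Arguments.
Unset Strict Implicit.
Unset Printing Implicit Defensive.

(** * Congruences, and commutation modulo a congruence *)

Section Congruence.
Variables (X : Type) (rel : seq X -> seq X -> Prop).

#[global] Instance generated_congruence_equiv :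
  Equivalence (generated_congruence rel).
Proof.
by split; [exact: gcongr_refl | exact: gcongr_sym | exact: gcongr_trans].
Qed.

#[global] Instance cat_generated_congruence :
  Proper (generated_congruence rel ==> generated_congruence rel
            ==> generated_congruence rel) (@cat X).
Proof. by move=> u1 v1 e1 u2 v2 e2; apply: gcongr_cat. Qed.

Lemma word_eval_congr (M : monoidType) (f : X -> M) u v :
  (forall u v, rel u v -> word_eval f u = word_eval f v) ->
  generated_congruence rel u v -> word_eval f u = word_eval f v.
Proof.
move=> relf; elim=> {u v}//.
- by move=> u v w _ -> _ ->.
- by move=> u1 v1 u2 v2 _ e1 _ e2; move: e1 e2; rewrite /word_eval !big_cat /= => -> ->.
Qed.

Definition congr_commute u v := generated_congruence rel (u ++ v) (v ++ u).

Lemma commuting_nil u : congr_commute u [::].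
Proof. by rewrite /congr_commute cats0; reflexivity. Qed.

Lemma commuting_sym u v : congr_commute u v -> congr_commute v u.
Proof. exact: gcongr_sym. Qed.

Lemma commuting_cat u v w :
  congr_commute u v -> congr_commute u w -> congr_commute u (v ++ w).
Proof.
by rewrite /congr_commute => uv uw; rewrite catA uv -catA uw catA; reflexivity.
Qed.

End Congruence.

(** * Consequences of the relations, with generators indexed by naturals *)

Section NormalForm.
Variable n : nat.

Local Notation "u ≡ v" := (generated_congruence (@RP_rel n) u v) (at level 70).
Local Notation commuting := (congr_commute (@RP_rel n)).

(* Out-of-range indices give the empty word. *)
Definition r_word (i : nat) : seq (RP_gen n) :=
  if insub i is Some j then [:: gen_r j] else [::].
Definition p_word (i : nat) : seq (RP_gen n) :=
  if insub i is Some j then [:: gen_p j] else [::].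

Lemma r_wordE (i : 'I_n.-1) j : i = j :> nat -> r_word j = [:: gen_r i].
Proof. by move=> <-; rewrite /r_word valK. Qed.

Lemma p_wordE (i : 'I_n) j : i = j :> nat -> p_word j = [:: gen_p i].
Proof. by move=> <-; rewrite /p_word valK. Qed.

Lemma r_word_ltn i : i.+1 < n ->
  exists i1 : 'I_n.-1, exists i2 i3 : 'I_n,
  [/\ i1 = i :> nat, i2 = i :> nat & i3 = i.+1 :> nat].
Proof.
move=> lt; have lt1 : i < n.-1 by lia.
by exists (Ordinal lt1), (Ordinal (ltnW lt)), (Ordinal lt).
Qed.

Lemma p_word_comm i j : commuting (p_word i) (p_word j).
Proof.
rewrite /congr_commute /p_word.
case: insubP => [i' _ _|_]; case: insubP => [j' _ _|_]; try reflexivity.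
by apply: gcongr_rel; constructor.
Qed.

Lemma p_word_idem i : p_word i ++ p_word i ≡ p_word i.
Proof.
rewrite /p_word; case: insubP => [i' _ _|_]; last reflexivity.
by apply: gcongr_rel; constructor.
Qed.

(** This merges [RP_pr_next] and [RP_pr_far]: only [i = j] and [i = j + 1], the ends of the slanted
    edge of [r_j], are excluded. *)
Lemma p_r_word_comm i j : (i < j) || (j.+1 < i) ->
  commuting (p_word i) (r_word j).
Proof.
rewrite /congr_commute /p_word /r_word.
case: insubP => [i' _ <-|_]; case: insubP => [j' _ <-|_] ij; try by rewrite ?cats0; reflexivity.
apply: gcongr_rel.
have [e|ne] := eqVneq (val j') i'.+1; first exact: RP_pr_next.
by apply: RP_pr_far; move: ne ij => /=; lia.
Qed.

Lemma r_word_comm i j : (i.+1 < j) || (j.+1 < i) ->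
  commuting (r_word i) (r_word j).
Proof.
rewrite /congr_commute /r_word.
case: insubP => [i' _ <-|_]; case: insubP => [j' _ <-|_] ij; try by rewrite ?cats0; reflexivity.
by apply: gcongr_rel; apply: RP_r_far.
Qed.

Lemma p_r_word i : i.+1 < n -> p_word i ++ r_word i ≡ r_word i.
Proof.
move=> /r_word_ltn[i1 [i2 [_ [e1 e2 _]]]].
rewrite (r_wordE e1) (p_wordE e2); apply: gcongr_sym; apply: gcongr_rel.
by apply: RP_r_pr; rewrite e1.
Qed.

Lemma r_p_wordS i : i.+1 < n -> r_word i ++ p_word i.+1 ≡ r_word i.
Proof.
move=> lt; have /r_word_ltn[i1 [i2 [i3 [e1 e2 e3]]]] := lt.
transitivity (p_word i ++ r_word i); last exact: p_r_word.
rewrite (r_wordE e1) (p_wordE e2) (p_wordE e3).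
by apply: gcongr_sym; apply: gcongr_rel; apply: RP_pr_rp; rewrite ?e1.
Qed.

Lemma r_p_word i : i.+1 < n -> r_word i ++ p_word i ≡ p_word i ++ p_word i.+1.
Proof.
move=> /r_word_ltn[i1 [i2 [i3 [e1 e2 e3]]]].
rewrite (r_wordE e1) (p_wordE e2) (p_wordE e3).
by apply: gcongr_rel; apply: RP_rp_pp; rewrite ?e1.
Qed.

Lemma r_r_word i : i.+1 < n -> r_word i ++ r_word i ≡ p_word i ++ p_word i.+1.
Proof.
move=> lt; have /r_word_ltn[i1 [i2 [_ [e1 e2 _]]]] := lt.
rewrite -(r_p_word lt) (r_wordE e1) (p_wordE e2).
transitivity [:: gen_r i1; gen_r i1; gen_r i1]; apply: gcongr_rel.
  exact: RP_sqr_cube.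
by apply: RP_cube_rp; rewrite e1.
Qed.

(** The chain is [p_{i+1} r_i = p_{i+1} p_i r_i = p_i p_{i+1} r_i = r_i p_i r_i = r_i r_i = p_i
    p_{i+1}]. *)
Lemma pS_r_word i : i.+1 < n ->
  p_word i.+1 ++ r_word i ≡ p_word i ++ p_word i.+1.
Proof.
move=> lt; rewrite -{1}(p_r_word lt) catA (p_word_comm i.+1 i) -(r_p_word lt).
by rewrite -catA (p_r_word lt) (r_r_word lt) (r_p_word lt); reflexivity.
Qed.

(* r_{b+k-1} ... r_b, which moves b + k to b *)
Fixpoint descent (b k : nat) : seq (RP_gen n) :=
  if k is k'.+1 then r_word (b + k') ++ descent b k' else [::].

(** * Commutation and absorption for descending products of the [r_i] *)

Lemma commuting_descent u b k :
  (forall j, b <= j < b + k -> commuting u (r_word j)) ->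
  commuting u (descent b k).
Proof.
elim: k => [|k IH] H /=; first exact: commuting_nil.
by apply: commuting_cat; [apply: H | apply: IH => j ?; apply: H]; lia.
Qed.

(** The letters after [r_{t-1}] have smaller index, so [p_t] commutes left past them and is absorbed
    by [r_{t-1} p_t = r_{t-1}]. *)
Lemma descent_p b k t : b + k < n -> b < t <= b + k ->
  descent b k ++ p_word t ≡ descent b k.
Proof.
elim: k => [|k IH] lt bt /=; first lia.
have [e|ne] := eqVneq t (b + k).+1; last by rewrite -catA IH; [reflexivity|lia|lia].
have /commuting_sym c : commuting (p_word t) (descent b k).
  by apply: commuting_descent => j ?; apply: p_r_word_comm; lia.
by rewrite -catA c catA e r_p_wordS; [reflexivity|lia].
Qed.

(** Once [p_{b+k}] has removed the starting vertex, the descent moves nothing: its first letter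
    turns into a further [p], by [pS_r_word], which [u] absorbs after the rest of the descent has
    disappeared by induction. *)
Lemma absorb_p_descent u b k : b + k < n ->
  (forall t, b <= t < b + k -> u ++ p_word t ≡ u) ->
  u ++ p_word (b + k) ++ descent b k ≡ u ++ p_word (b + k).
Proof.
elim: k => [|k IH] lt H /=; first by rewrite cats0; reflexivity.
have c : commuting (p_word (b + k).+1) (descent b k).
  by apply: commuting_descent => j ?; apply: p_r_word_comm; lia.
have IHk : u ++ p_word (b + k) ++ descent b k ≡ u ++ p_word (b + k).
  by apply: IH => [|t ?]; [lia | apply: H; lia].
have Hk : u ++ p_word (b + k) ≡ u by apply: H; lia.
rewrite addnS (catA (p_word _)) pS_r_word; last lia.
rewrite -!catA c !catA -(catA u) IHk Hk; reflexivity.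
Qed.

(** * Normal words and what they absorb *)

(** A fixed vertex, [o = Some a], contributes the empty word. *)
Definition letter (a : nat) (o : option nat) : seq (RP_gen n) :=
  if o is Some b then descent b (a - b) else p_word a.

Fixpoint normal_word (F : nat -> option nat) (k : nat) : seq (RP_gen n) :=
  if k is k'.+1 then normal_word F k' ++ letter k' (F k') else [::].

Definition regular (F : nat -> option nat) :=
  (forall a b, F a = Some b -> b <= a) /\
  (forall a a' b b', a < a' -> F a = Some b -> F a' = Some b' -> b < b').

Lemma eq_normal_word F G k :
  (forall a, a < k -> F a = G a) -> normal_word F k = normal_word G k.
Proof.
elim: k => //= k IH H; rewrite IH ?H // => a lt; exact/H/ltnW.
Qed.

(** A generator affects only the letters near its index; the common letters beyond them are appended
    to both sides. *)
Lemma normal_word_congr g F G k m : k <= m ->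
  (forall a, k <= a < m -> F a = G a) ->
  g ++ normal_word F k ≡ normal_word G k ->
  g ++ normal_word F m ≡ normal_word G m.
Proof.
move=> le H e; elim: m le H => [|m IH] le H; first by move: le e; case: k {H}.
move: le; rewrite leq_eqVlt => /orP[/eqP <- //|lt] /=.
by rewrite catA IH ?H; [reflexivity | lia | lia | move=> a ?; apply: H; lia].
Qed.

Lemma commuting_normal_word u F k :
  (forall a, a < k -> commuting u (letter a (F a))) ->
  commuting u (normal_word F k).
Proof.
elim: k => [|k IH] H /=; first exact: commuting_nil.
apply: commuting_cat; last exact: H.
by apply: IH => a lt; exact/H/ltnW.
Qed.

(** For [a < i], the letter at [a] is [p_a] or a product of [r_j] with [j < a], hence
    [j + 1 < i]. *)
Lemma p_normal_word_comm F i : regular F ->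
  commuting (p_word i) (normal_word F i).
Proof.
case=> dF _; apply: commuting_normal_word => a lt; rewrite /letter.
case e: (F a) => [b|]; last exact: p_word_comm.
by have ba := dF _ _ e; apply: commuting_descent => j ?; apply: p_r_word_comm; lia.
Qed.

Lemma r_normal_word_comm F i : regular F ->
  commuting (r_word i) (normal_word F i).
Proof.
case=> dF _; apply: commuting_normal_word => a lt; rewrite /letter.
case e: (F a) => [b|]; last by apply/commuting_sym/p_r_word_comm; lia.
by have ba := dF _ _ e; apply: commuting_descent => j ?; apply: r_word_comm; lia.
Qed.

(** If the last letter is a descent to [b], it absorbs [p_t] when [b < t], and lets it pass to the
    shorter prefix when [t < b]. If it is [p_k], idempotence settles [t = k] and commutation the
    rest. *)
Lemma normal_word_absorb F k t : regular F -> k <= n -> t < k ->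
  (forall a, a < k -> F a <> Some t) ->
  normal_word F k ++ p_word t ≡ normal_word F k.
Proof.
case=> dF mF; elim: k => // k IH lt tk H /=; rewrite -catA.
have IHt : t < k -> normal_word F k ++ p_word t ≡ normal_word F k.
  by move=> tk'; apply: IH => // [|a ?]; [exact: ltnW | apply: H; lia].
rewrite /letter; case e: (F k) => [b|].
  have bk := dF _ _ e.
  have tb : t <> b by move=> tb; apply: (H k) => //; rewrite tb.
  have [bt|tb'] := ltnP b t.
    by rewrite descent_p; [reflexivity | lia | lia].
  have /commuting_sym c : commuting (p_word t) (descent b (k - b)).
    by apply: commuting_descent => j ?; apply: p_r_word_comm; lia.
  by rewrite c catA IHt; [reflexivity | lia].
have [->|ne] := eqVneq t k; first by rewrite p_word_idem; reflexivity.
by rewrite (p_word_comm k t) catA IHt; [reflexivity | lia].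
Qed.

(** Monotonicity puts the earlier images below [b], so the prefix absorbs every [p_t] with
    [b <= t < i], as [absorb_p_descent] requires. *)
Lemma normal_word_kill F i : regular F -> i < n ->
  normal_word F i ++ p_word i ++ letter i (F i) ≡ normal_word F i ++ p_word i.
Proof.
move=> rF lt; have [dF mF] := rF; rewrite /letter.
case e: (F i) => [b|]; last by rewrite p_word_idem; reflexivity.
have bi := dF _ _ e; rewrite -{2 5}(subnKC bi); apply: absorb_p_descent; first lia.
move=> t bt; apply: normal_word_absorb => //; [exact: ltnW | lia |].
by move=> a ai ea; have := mF _ _ _ _ ai ea e; lia.
Qed.

(** * The action of words on vertices, and reduction to normal form *)

Definition gen_map (g : RP_gen n) (a : nat) : option nat :=
  match g with
  | gen_r i => if a == i :> nat then None
               else if a == i.+1 then Some (val i) else Some a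
  | gen_p i => if a == i :> nat then None else Some a
  end.

Fixpoint word_map (w : seq (RP_gen n)) (a : nat) : option nat :=
  if w is g :: w' then obind (word_map w') (gen_map g a) else Some a.

Lemma regular_gen g F : regular F -> regular (fun a => obind F (gen_map g a)).
Proof.
case=> dF mF; split=> [a b|a a' b b' lt].
  by case: g => i /=; do 2?(case: eqP => //= ?); move=> /dF; lia.
by case: g => i /=; do 4?(case: eqP => //= ?);
  first [apply: mF; lia | lia].
Qed.

Lemma regular_word_map w : regular (word_map w).
Proof.
elim: w => [|g w IH]; last exact: regular_gen.
by split=> [a b [->] | a a' b b' lt [<-] [<-]].
Qed.

(** Prepending [p_i] changes only the letter at [i], and prepending [r_i] only those at [i] and
    [i + 1]. The generator first commutes past the letters before [i]. *)
Lemma gen_normal_word g F : regular F ->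
  [:: g] ++ normal_word F n ≡ normal_word (fun a => obind F (gen_map g a)) n.
Proof.
move=> rF; have rG := regular_gen g rF; have [dF mF] := rF.
case: g rG => i rG.
  have lt : i.+1 < n by have := ltn_ord i; lia.
  apply: (@normal_word_congr _ _ _ i.+2) => [//|a ia|].
    by rewrite /gen_map !gtn_eqF //; lia.
  rewrite -(r_wordE (erefl (val i))) /= eqxx gtn_eqF //= eqxx /=.
  rewrite (@eq_normal_word _ F i); last first.
    by move=> a ai; rewrite !ltn_eqF //=; lia.
  rewrite !catA (r_normal_word_comm i rF).
  case e: (F i) => [b|] /=; last first.
    (* As [F i = None], [G] has the same values as [F]; writing out the value at [i] makes its
       normal word end in [p_i] at length [i + 1]. *)
    set G := fun a => if a == i :> nat then None else F a.
    have rG' : regular G.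
      split=> [a b|a a' b b']; rewrite /G; case: eqP => //= _; first exact: dF.
      by case: eqP => //= _; exact: mF.
    rewrite -(catA (normal_word _ _)) (r_p_word lt).
    have := normal_word_kill rG' lt.
    rewrite /= (@eq_normal_word G F i); last first.
      by move=> a ai; rewrite /G ltn_eqF.
    by rewrite /G eqxx gtn_eqF //= !catA.
  have bi := dF _ _ e.
  (* Now [r_i] extends the descent from [i] to one from [i + 1], the new letter at [i + 1]. The new
     [p_i] and the old letter at [i + 1] must vanish next to it. *)
  rewrite -!catA (catA (r_word i)).
  have -> : r_word i ++ descent b (i - b) = descent b (i.+1 - b).
    by rewrite subSn //= subnKC.
  have p_desc : p_word i ++ descent b (i.+1 - b) ≡ descent b (i.+1 - b).
    by rewrite subSn //= subnKC // catA (p_r_word lt); reflexivity.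
  have desc_p t : b < t <= i.+1 ->
      descent b (i.+1 - b) ++ p_word t ≡ descent b (i.+1 - b).
    by move=> bt; apply: descent_p; lia.
  rewrite p_desc; case e': (F i.+1) => [c|] /=; last first.
    by rewrite desc_p; [reflexivity | lia].
  have ci := dF _ _ e'; have bc := mF _ _ _ _ (ltnSn i) e e'.
  (* A [p_{i+1}] is inserted so that [absorb_p_descent] can remove the descent from [i + 1] to [c];
     since [b < c], every [p_t] needed is absorbed. *)
  rewrite -{1}(desc_p i.+1); last lia.
  rewrite -{2}(subnKC ci) -!catA absorb_p_descent; [|lia|].
    by rewrite subnKC // desc_p; [reflexivity | lia].
  by move=> t ct; apply: desc_p; lia.
have lt := ltn_ord i.
apply: (@normal_word_congr _ _ _ i.+1) => [//|a ia|].
  by rewrite /gen_map !gtn_eqF //; lia.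
rewrite -(p_wordE (erefl (val i))) /= eqxx /=.
rewrite (@eq_normal_word _ F i); last by move=> a ai; rewrite !ltn_eqF.
by rewrite catA (p_normal_word_comm i rF) -catA normal_word_kill //; reflexivity.
Qed.

Lemma word_congr_normal w : w ≡ normal_word (word_map w) n.
Proof.
elim: w => [|g w IH].
  have -> k : normal_word (word_map [::]) k = [::]; last reflexivity.
  by elim: k => //= k ->; rewrite subnn.
apply: gcongr_trans (gen_normal_word g (regular_word_map w)).
exact: gcongr_cat (gcongr_refl _ [:: g]) IH.
Qed.

(** * Comparison of words with the diagrams they denote *)

Lemma word_map_cat u v a : word_map (u ++ v) a = obind (word_map v) (word_map u a).
Proof.
by elim: u a => [|g u IH] a //=; case: (gen_map g a) => //= b; rewrite IH.
Qed.

Lemma word_map_descent b k a : b + k < n -> word_map (descent b k) a =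
  if a == b + k then Some b else if b <= a < b + k then None else Some a.
Proof.
elim: k a => [|k IH] a lt /=.
  by rewrite addn0; case: eqP => [->|] //; case: ifP => //; lia.
have ltk : (b + k).+1 < n by lia.
have [i1 [_ [_ [e1 _ _]]]] := r_word_ltn ltk.
rewrite (r_wordE e1) /= e1 addnS; case: eqP => [->|/= ne] /=.
  by do 2?(case: ifP => //); lia.
case: eqP => [e|ne'] /=; rewrite IH ?e ?eqxx //; try lia.
by do 3?(case: ifP => //); lia.
Qed.

(** The letter at [k] sends [k] to [b] and kills only [b, ..., k - 1]; the images of earlier
    vertices lie below [b] and stay put. *)
Lemma word_map_normal F k a : regular F -> k <= n ->
  word_map (normal_word F k) a = if a < k then F a else Some a.
Proof.
case=> dF mF; elim: k a => //= k IH a lt; rewrite word_map_cat IH; last exact: ltnW.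
have map_p c : word_map (p_word k) c = if c == k then None else Some c.
  by rewrite (@p_wordE (Ordinal lt) k) //=; case: ifP.
have map_letter b : b <= k -> word_map (descent b (k - b)) =1
    fun c => if c == k then Some b else if b <= c < k then None else Some c.
  by move=> bk c; rewrite word_map_descent subnKC.
rewrite ltnS [a <= k]leq_eqVlt; case: (ltngtP a k) => [ak|ka|->] /=.
- case e: (F a) => [c|] //=; have ca := dF _ _ e.
  rewrite /letter; case e': (F k) => [b|]; last by rewrite map_p ltn_eqF //; lia.
  rewrite map_letter; last exact: dF.
  have := mF _ _ _ _ ak e e'; rewrite ltn_eqF; last lia.
  by case: ifP => //; lia.
- rewrite /letter; case e': (F k) => [b|]; last by rewrite map_p gtn_eqF.
  rewrite map_letter; last exact: dF.
  by rewrite gtn_eqF //; case: ifP => //; lia.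
- rewrite /letter; case e': (F k) => [b|]; last by rewrite map_p eqxx.
  by rewrite map_letter ?eqxx //; exact: dF.
Qed.

Lemma gen_mapP g (a c : 'I_n) :
  ((a, c) \in edges (RP_val (RP_gen_diagram g))) = (gen_map g a == Some (val c)).
Proof.
have N : (None == Some (val c)) = false by [].
by case: g => i; rewrite inE /= -?val_eqE /=; do 2?(case: ifP => ?);
  rewrite ?(inj_eq Some_inj) ?N; lia.
Qed.

Lemma word_mapP w (a c : 'I_n) :
  ((a, c) \in edges (RP_val (word_eval (@RP_gen_diagram n) w)))
    = (word_map w a == Some (val c)).
Proof.
elim: w a => [|g w IH] a; rewrite /word_eval ?big_nil ?big_cons /=.
  by rewrite inE /= -val_eqE.
apply/stackP/idP => [[b]|].
  by rewrite gen_mapP IH => /eqP -> /= /eqP ->.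
case e: (gen_map g a) => [b|] //=.
have bn : b < n.
  have := ltn_ord a; move: e.
  by case: g => i /=; do 2?(case: eqP => //= ?); case=> <-; lia.
move=> H; exists (Ordinal bn); first by rewrite gen_mapP e.
by rewrite IH.
Qed.

Lemma word_map_ltn w (a : 'I_n) b : word_map w a = Some b -> b < n.
Proof.
by move=> e; have [/(_ _ _ e) le _] := regular_word_map w; apply: leq_ltn_trans le _.
Qed.

Lemma word_eval_mapP u v :
  word_eval (@RP_gen_diagram n) u = word_eval (@RP_gen_diagram n) v <->
  (forall a, a < n -> word_map u a = word_map v a).
Proof.
split=> [E a lt | E]; last first.
  by do 2!apply: val_inj; apply/setP => -[a c] /=; rewrite !word_mapP E.
have H (c : 'I_n) : (word_map u a == Some (val c)) = (word_map v a == Some (val c)).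
  by rewrite -[a]/(val (Ordinal lt)) -!word_mapP E.
case eu: (word_map u a) => [b|].
  have bn := @word_map_ltn u (Ordinal lt) b eu.
  by have := H (Ordinal bn); rewrite eu eqxx => /esym/eqP.
case ev: (word_map v a) => [b|] //.
have bn := @word_map_ltn v (Ordinal lt) b ev.
by have := H (Ordinal bn); rewrite eu ev eqxx.
Qed.

Lemma word_eval_rel u v : RP_rel u v ->
  word_eval (@RP_gen_diagram n) u = word_eval (@RP_gen_diagram n) v.
Proof.
move=> uv; apply/word_eval_mapP => a _; case: uv => * /=;
  by do 8?(case: eqP => //= ?); first [lia | congr Some; lia].
Qed.

(** * Every diagram comes from a normal word *)

Definition diagram_map (d : planar_rook n) (a : nat) : option nat :=
  if insub a is Some i then omap val [pick b | (i, b) \in edges d] else None.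

(** At most one edge leaves [a], so the choice made by [pick] is forced. *)
Lemma diagram_mapP d (a c : 'I_n) :
  ((a, c) \in edges d) = (diagram_map d a == Some (val c)).
Proof.
have /is_planar_rookP dP := edgesP d.
rewrite /diagram_map valK; case: pickP => [b ab|/(_ c) -> //].
apply/idP/eqP => [ac|[/val_inj <- //]].
by have [/(_ erefl) ->] := dP _ _ _ _ ab ac.
Qed.

Lemma diagram_map_edge d a b : diagram_map d a = Some b ->
  exists a' b' : 'I_n, [/\ val a' = a, val b' = b & (a', b') \in edges d].
Proof.
rewrite /diagram_map; case: insubP => // i _ <-.
by case: pickP => //= c ic [<-]; exists i, c.
Qed.

Lemma regular_diagram_map (d : RP n) : regular (diagram_map (RP_val d)).
Proof.
have /right_diagramP rP := RP_valP d.
have /is_planar_rookP dP := edgesP (RP_val d).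
split=> [a b /diagram_map_edge[a' [b' [<- <-]]]|]; first exact: rP.
move=> a1 a2 b1 b2 lt /diagram_map_edge[a1' [b1' [e1 <- h1]]].
move=> /diagram_map_edge[a2' [b2' [e2 <- h2]]]; rewrite -e1 -e2 in lt.
have [_ inj mono] := dP _ _ _ _ h1 h2.
rewrite ltn_neqAle mono // andbT; apply/eqP => /val_inj/inj E.
by rewrite E ltnn in lt.
Qed.

Lemma normal_word_diagram (d : RP n) :
  word_eval (@RP_gen_diagram n) (normal_word (diagram_map (RP_val d)) n) = d.
Proof.
do 2!apply: val_inj; apply/setP => -[a c] /=.
rewrite word_mapP word_map_normal //; last exact: regular_diagram_map.
by rewrite ltn_ord diagram_mapP.
Qed.

End NormalForm.

Theorem theorem2p3 (n : nat) :
  monoid_presentation (@RP_rel n) (@RP_gen_diagram n).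
Proof.
split=> [d|u v]; first by eexists; exact: normal_word_diagram.
split=> [/word_eval_mapP E|]; last exact/word_eval_congr/word_eval_rel.
(* Equal diagrams give equal maps below [n], hence literally the same normal word. *)
rewrite (word_congr_normal u) (word_congr_normal v) (@eq_normal_word n _ _ n E).
reflexivity.
Qed.
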